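(* For any real number $\varepsilon$ with $0<\varepsilon<\frac12$, there is a constant $C=C(\varepsilon)<\frac{(1+\varepsilon)^2}{4\varepsilon^2(1-\varepsilon)}$ such that for every $\varepsilon n$-connected graph $G$, where $n$ is the order of $G$, one has $md(G)\leq C$.
   Context: Graphs are finite and simple. ''$\varepsilon n$-connected'' means that the (vertex-)connectivity of $G$ is at least $\varepsilon n$, $n=|V(G)|$. An edge-coloring of $G$ assigns a color (positive integer) to each edge; adjacent edges may have the same color. An edge-cut is monochromatic if all of its edges have the same color. An edge-coloring of $G$ is a monochromatic disconnection coloring ($MD$-coloring) if every two distinct vertices of $G$ are separated by a monochromatic edge-cut (i.e. there is a set of edges of a single color whose deletion puts the two vertices in different components). For a connected graph $G$, $md(G)$ is the maximum number of colors used in an $MD$-coloring of $G$. *)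

(* Defs.v *)
From mathcomp Require Import all_boot.
From mathcomp Require Import boolp.

Set Implicit Arguments.
Unset Strict Implicit.
Unset Printing Implicit Defensive.

Record sgraph := SGraph {
  svertex :> finType;
  sadj : rel svertex;
  sadj_sym : symmetric sadj;
  sadj_irrefl : irreflexive sadj
}.

Definition edges (G : sgraph) : {set {set G}} :=
  [set [set p.1; p.2] | p : G * G & sadj p.1 p.2].

(* Adjacency in G - S. *)
Definition vdel_adj (G : sgraph) (S : {set G}) : rel G :=
  [rel x y | [&& x \notin S, y \notin S & sadj x y]].

Definition vdel_disconnected (G : sgraph) (S : {set G}) : bool :=
  [exists x, exists y,
     [&& x \notin S, y \notin S & ~~ connect (vdel_adj S) x y]].

(* The least number of vertices whose deletion leaves a disconnected graph or
   at most one vertex, so that the complete graph on n > 0 vertices has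
   connectivity n - 1.  The default value #|G| is attained by S := setT, hence
   it never affects the minimum. *)
Definition connectivity (G : sgraph) : nat :=
  \big[minn/#|G|]_(S : {set G} | vdel_disconnected S || (#|~: S| <= 1)) #|S|.

(* Colorings are total on {set G}; only their values on edges G are ever
   used. *)
Definition edge_coloring (G : sgraph) (c : {set G} -> nat) : Prop :=
  {in edges G, forall e, 0 < c e}.

Definition ncolors (G : sgraph) (c : {set G} -> nat) : nat :=
  size (undup [seq c e | e <- enum (edges G)]).

(* Adjacency in G - F. *)
Definition edel_adj (G : sgraph) (F : {set {set G}}) : rel G :=
  [rel x y | sadj x y && ([set x; y] \notin F)].

Definition monochromatic (G : sgraph) (c : {set G} -> nat)
    (F : {set {set G}}) : Prop :=
  exists k, {in F, forall e, c e = k}.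

Definition MD_coloring (G : sgraph) (c : {set G} -> nat) : Prop :=
  edge_coloring c /\
  forall x y : G, x != y ->
    exists F : {set {set G}},
      [/\ F \subset edges G, monochromatic c F & ~~ connect (edel_adj F) x y].

Definition MD_with_colors (G : sgraph) (n : nat) : bool :=
  `[< exists c : {set G} -> nat, MD_coloring c /\ ncolors c = n >].

Lemma MD_with_colors_ex (G : sgraph) : exists n, MD_with_colors G n.
Proof.
exists (ncolors (fun _ : {set G} => 1)); apply/asboolP.
exists (fun=> 1); split=> //; split=> // x y neq_xy.
exists (edges G); split=> //; first by exists 1.
apply/connectP=> -[[|z p] /=]; first by move=> _ yx; rewrite yx eqxx in neq_xy.
case/andP=> /andP[xz /negP xzE] _ _; apply: xzE.
by apply/imsetP; exists (x, z); rewrite ?inE.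
Qed.

Lemma MD_with_colors_ub (G : sgraph) (n : nat) :
  MD_with_colors G n -> n <= #|edges G|.
Proof.
move=> /asboolP[c [_ <-]].
by rewrite (leq_trans (size_undup _)) // size_map -cardE.
Qed.

(* The maximum is taken over colorings with arbitrary positive integer colors;
   meaningful for connected G, total for convenience. *)
Definition md (G : sgraph) : nat :=
  ex_maxn (MD_with_colors_ex G) (@MD_with_colors_ub G).

(* Main.v *)
Require Import Defs.
From mathcomp Require Import all_boot all_order all_algebra.
From mathcomp Require Import boolp reals.
From mathcomp Require Import zify lra.
Import Order.TTheory GRing.Theory Num.Theory.
Local Open Scope ring_scope.

(** The bound comes from a sharper inequality on every graph [G] with positive
    connectivity [k] and order [n]: [(md G + 1) * k + 2 <= 2 * n] ([md_bound]).

    Fix an MD-coloring.  Two vertices are separated by deleting a suitable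
    color; for the ends of an edge this can only be the color of that edge.
    Fix a vertex [v], let [K] be a set of colors and let [U] be the set of
    vertices reached from [v] along edges with colors in [K].  Every edge
    leaving [U] has a color outside [K].  Let [j] be the color of such an edge,
    let [A] be the set of all vertices joined to [U] from outside by an edge of
    color [j], and let [x] be in [A].  Then
    - [x] has exactly one neighbor in [U] ([cluster_exit_uniq]);
    - a neighbor of [x] outside [U] and [A] has no neighbor in [U]
      ([exit_neighbor_far]).
    Both say that [G] behaves like a subgraph of a Cartesian product with one
    factor for each color, in which [U] lies in a slice where only the
    coordinates of [K] vary.  When [j] is added to [K], the set [U] gains at
    least the [#|A|] vertices of [A], while its closed neighborhood gains the
    neighbors of [x] outside [U] and [A], at least [deg x - #|A|] many.  So
    [potential U], the order of [U] plus that of its closed neighborhood, grows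
    by at least [deg x >= k] ([potential_growth]), whatever the size of [A].
    The potential is at least [k + 2] when [K] is empty and never exceeds
    [2 * n].  As [G] is connected, [U] can be left as long as [K] misses a color
    ([cluster_exit_ex]), so all colors are added, and the inequality follows.

    If [eps * n <= k], this gives [md G + 1 <= 2 / eps] for nonempty [G], and
    [C := 2 / eps - 1] is small enough because
    [(1 + eps) ^ 2 - 8 * eps * (1 - eps) = (1 - 3 * eps) ^ 2 >= 0]. *)

(** * Vertex connectivity, minimum degree and connectedness *)

Section Connectivity.
Set Implicit Arguments.
Unset Strict Implicit.
Unset Printing Implicit Defensive.
Local Open Scope nat_scope.
Variable G : sgraph.

Definition neighborhood (x : G) : {set G} := [set y | sadj x y].

Lemma connectivity_le (S : {set G}) :
  vdel_disconnected S || (#|~: S| <= 1) -> connectivity G <= #|S|.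
Proof.
move=> PS; rewrite /connectivity -minEnat -leEnat.
exact: (bigmin_le_cond _ (P := fun S => vdel_disconnected S || (#|~: S| <= 1))).
Qed.

(** Deleting the neighbors of [x] isolates [x], or leaves [x] alone. *)
Lemma connectivity_le_degree (x : G) : connectivity G <= #|neighborhood x|.
Proof.
apply: connectivity_le; case: leqP => [|lt1]; rewrite ?orbT ?orbF //.
have xN : x \in ~: neighborhood x by rewrite !inE sadj_irrefl.
move: lt1; rewrite (cardsD1 x) xN ltnS card_gt0 => /set0Pn[y].
rewrite !inE => /andP[yx Nxy].
apply/existsP; exists x; apply/existsP; exists y; rewrite !inE sadj_irrefl Nxy /=.
apply/connectP=> -[[|z p] /=]; first by move=> _ yE; rewrite yE eqxx in yx.
by case/andP=> /and3P[_]; rewrite !inE => /negP.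
Qed.

Lemma connectivity_gt0_connect (x y : G) :
  0 < connectivity G -> connect (@sadj G) x y.
Proof.
apply: contraLR => Nxy; rewrite -leqNgt -(cards0 G).
apply: connectivity_le; apply/orP; left.
apply/existsP; exists x; apply/existsP; exists y; rewrite !inE /=.
apply: contra Nxy; apply: connect_sub => a b /=.
by rewrite /vdel_adj /= !inE => ab; apply: connect1.
Qed.

End Connectivity.

(** * Separation by colors *)

Section Coloring.
Set Implicit Arguments.
Unset Strict Implicit.
Unset Printing Implicit Defensive.
Local Open Scope nat_scope.
Variables (G : sgraph) (c : {set G} -> nat).

Definition color_adj (K : pred nat) : rel G :=
  [rel x y | sadj x y && K (c [set x; y])].

Lemma color_adj_sym K : symmetric (color_adj K).
Proof. by move=> x y; rewrite /color_adj /= sadj_sym setUC. Qed.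

Lemma connect_color_sym K : connect_sym (color_adj K).
Proof. exact/sym_connect_sym/color_adj_sym. Qed.

Lemma connect_color_sub K L (x y : G) :
  subpred K L -> connect (color_adj K) x y -> connect (color_adj L) x y.
Proof.
move=> KL; apply: connect_sub => a b /andP[ab Kab]; apply: connect1.
by rewrite /color_adj /= ab KL.
Qed.

Lemma mem_edges (x y : G) : sadj x y -> [set x; y] \in edges G.
Proof. by move=> xy; apply/imsetP; exists (x, y); rewrite ?inE. Qed.

Hypothesis c_MD : MD_coloring c.

Lemma MD_separated (x y : G) : x != y ->
  exists k, ~~ connect (color_adj (predC1 k)) x y.
Proof.
move=> /(proj2 c_MD)[F [_ [k Fk] NF]]; exists k; apply: contra NF.
apply: connect_sub => a b /andP[ab /= cab]; apply: connect1.
rewrite /edel_adj /= ab /=; apply: contra cab => abF.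
by apply/eqP; apply: Fk.
Qed.

(** A color other than that of [xy] leaves the edge [xy] in place, so it cannot
    be the one separating [x] from [y]. *)
Lemma MD_edge_separated (x y : G) : sadj x y ->
  ~~ connect (color_adj (predC1 (c [set x; y]))) x y.
Proof.
move=> xy; have xNy : x != y by apply: contraL xy => /eqP->; rewrite sadj_irrefl.
have [k Nk] := MD_separated xNy; suff <- : k = c [set x; y] by [].
apply/eqP; apply: contraNT Nk => kNc; apply: connect1.
by rewrite /color_adj /= xy eq_sym.
Qed.

(** * The vertices reached through a set of colors *)

Section Cluster.
Variables (v : G) (K : pred nat).

Definition cluster : {set G} := [set x | connect (color_adj K) v x].

Definition closed_neighborhood (U : {set G}) : {set G} :=
  U :|: \bigcup_(u in U) neighborhood u.

Definition cluster_exits (j : nat) : {set G} :=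
  [set x | (x \notin cluster) &&
           [exists u in cluster, sadj u x && (c [set u; x] == j)]].

Lemma cluster_connect l (u u' : G) : ~~ K l ->
  u \in cluster -> u' \in cluster -> connect (color_adj (predC1 l)) u u'.
Proof.
rewrite !inE => NKl vu vu'.
apply: (@connect_color_sub K) => [i Ki /=|]; first by apply: contraNneq NKl => <-.
by apply: connect_trans vu'; rewrite connect_color_sym.
Qed.

Lemma cluster_exit_color (u x : G) : u \in cluster -> x \notin cluster ->
  sadj u x -> ~~ K (c [set u; x]).
Proof.
rewrite !inE => vu Nvx ux; apply: contra Nvx => Kux.
by apply: connect_trans vu (connect1 _); rewrite /color_adj /= ux.
Qed.

Lemma color_adj1 l (x y : G) :
  sadj x y -> c [set x; y] != l -> connect (color_adj (predC1 l)) x y.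
Proof. by move=> xy cxy; apply: connect1; rewrite /color_adj /= xy. Qed.

(** If [ux] and [u'x] had different colors, the path through [U] and [x] would
    join the ends of [ux] without the color of [ux].  If they have the same
    color, that color does not separate [u] from [u'], which are joined inside
    [U], and any other color spares the path [u x u']. *)
Lemma cluster_exit_uniq (u u' x : G) : u \in cluster -> u' \in cluster ->
  x \notin cluster -> sadj u x -> sadj u' x -> u = u'.
Proof.
move=> Uu Uu' NUx ux u'x; apply/eqP; apply: contraT => uu'.
have NKu := cluster_exit_color Uu NUx ux.
have same_color : c [set u'; x] = c [set u; x].
  apply/eqP; apply: contraT => cN; have := MD_edge_separated ux.
  rewrite (connect_trans (cluster_connect NKu Uu Uu')) //.
  exact: color_adj1.
have [k] := MD_separated uu'.
have [<-|kN] := eqVneq (c [set u; x]) k.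
  by rewrite cluster_connect.
rewrite (connect_trans (color_adj1 ux kN)) // connect_color_sym.
by apply: color_adj1; rewrite // same_color.
Qed.

(** Suppose [y] has a neighbor [w] in [U], and let [u] in [U] be joined to [x]
    by color [j].  In the closed walk [w - y - x - u] completed inside [U], the
    edge [wy] has a color other than [j] as [y] is not in the set of exits.  If
    [xy] and [wy] have the same color, then [ux] is the only edge of color [j]
    on the walk; otherwise [wy] is the only edge of its color.  In both cases
    the rest of the walk contradicts [MD_edge_separated]. *)
Lemma exit_neighbor_far j (x y : G) : x \in cluster_exits j -> sadj x y ->
  y \notin cluster -> y \notin cluster_exits j ->
  y \notin closed_neighborhood cluster.
Proof.
rewrite [x \in _]inE => /andP[NUx /exists_inP[u Uu /andP[ux /eqP cux]]].
move=> xy NUy NAy; rewrite inE (negPf NUy) /=; apply/bigcupP => -[w Uw].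
rewrite inE => wy.
have NKw := cluster_exit_color Uw NUy wy.
have NKu := cluster_exit_color Uu NUx ux.
have cwy : c [set w; y] != c [set u; x].
  apply: contra NAy; rewrite cux inE NUy => cwyj.
  by apply/exists_inP; exists w => //; rewrite wy.
have [cxy|cxy] := eqVneq (c [set x; y]) (c [set w; y]).
  have := MD_edge_separated ux.
  rewrite (connect_trans (cluster_connect NKu Uu Uw)) //.
  rewrite (connect_trans (color_adj1 wy cwy)) // connect_color_sym.
  by apply: color_adj1 => //; rewrite cxy.
have := MD_edge_separated wy.
rewrite (connect_trans (cluster_connect NKw Uw Uu)) //.
rewrite eq_sym in cwy.
by rewrite (connect_trans (color_adj1 ux cwy)) // color_adj1.
Qed.

End Cluster.

(** * Growth of the potential *)

Definition potential (U : {set G}) := #|U| + #|closed_neighborhood U|.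

Lemma cluster_sub v K j : cluster v K \subset cluster v (predU1 j K).
Proof.
apply/subsetP => x; rewrite !inE; apply: connect_color_sub => i Ki.
by rewrite /= Ki orbT.
Qed.

Lemma cluster_exits_sub v K j :
  cluster_exits v K j \subset cluster v (predU1 j K).
Proof.
apply/subsetP => x; rewrite inE => /andP[_ /exists_inP[u Uu /andP[ux /eqP cux]]].
have := subsetP (cluster_sub v K j) u Uu; rewrite !inE => vu.
by apply: connect_trans vu (connect1 _); rewrite /color_adj /= ux cux eqxx.
Qed.

(** The gain [#|A|] of the cluster compensates the neighbors of [x] that are not
    new in the closed neighborhood: at most one in [U], and at most [#|A| - 1]
    in [A], which contains [x] itself. *)
Lemma potential_growth v K j x : x \in cluster_exits v K j ->
  potential (cluster v K) + #|neighborhood x|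
    <= potential (cluster v (predU1 j K)).
Proof.
move=> Ax; rewrite /potential.
set U := cluster v K; set A := cluster_exits v K j; set U' := cluster v _.
have sUU' : U \subset U' := cluster_sub v K j.
have sAU' : A \subset U' := cluster_exits_sub v K j.
have UA0 : [disjoint U & A].
  by apply/pred0P => y /=; rewrite [y \in A]inE; case: (y \in U).
have NUx : x \notin U by move: Ax; rewrite inE => /andP[].
have leU : #|U| + #|A| <= #|U'|.
  rewrite -cardsUI (disjoint_setI0 UA0) cards0 addn0.
  by rewrite subset_leq_card // subUset sUU'.
pose B := neighborhood x :\: (U :|: A).
have leN : #|closed_neighborhood U| + #|B| <= #|closed_neighborhood U'|.
  rewrite -cardsUI [_ :&: B](_ : _ = set0) ?cards0 ?addn0; last first.
    apply/setP => y; rewrite [RHS]inE inE; apply/negP => /andP[Ny].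
    rewrite !in_setD in_setU negb_or => /andP[/andP[NUy NAy]].
    by rewrite inE => xy; move/negP: (exit_neighbor_far Ax xy NUy NAy).
  apply: subset_leq_card; rewrite !subUset -andbA; apply/and3P; split.
  - exact: subset_trans sUU' (subsetUl _ _).
  - apply: subset_trans (subsetUr _ _); apply/bigcupsP => u Uu.
    by apply: (bigcup_max u) => //; apply: (subsetP sUU').
  - apply: subset_trans (subsetUr _ _); apply: (bigcup_max x).
      exact: (subsetP sAU').
    exact: subsetDl.
have leUx : #|neighborhood x :&: U| <= 1.
  apply/card_le1_eqP => u w; rewrite !in_setI ![_ \in neighborhood _]inE.
  rewrite ![sadj x _]sadj_sym => /andP[ux Uu] /andP[wx Uw].
  by rewrite (cluster_exit_uniq Uu Uw NUx).
have leAx : #|neighborhood x :&: A| < #|A|.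
  apply: proper_card; apply/properP; split; first exact: subsetIr.
  by exists x; rewrite // !inE sadj_irrefl.
have leNx : #|neighborhood x| <=
    #|neighborhood x :&: U| + #|neighborhood x :&: A| + #|B|.
  rewrite -(cardsID (U :|: A) (neighborhood x)) leq_add2r setIUr.
  by rewrite cardsU leq_subr.
lia.
Qed.

Lemma edge_connect_color (K : pred nat) (x y : G) : sadj x y ->
  connect (color_adj K) x y -> K (c [set x; y]).
Proof.
move=> xy; apply: contraLR => NK; apply: contra (MD_edge_separated xy).
by apply: connect_color_sub => i Ki /=; apply: contraNneq NK => <-.
Qed.

Definition colors : seq nat := undup [seq c e | e <- enum (edges G)].

Lemma mem_colors (x y : G) : sadj x y -> c [set x; y] \in colors.
Proof. by move=> xy; rewrite mem_undup map_f // mem_enum mem_edges. Qed.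

Lemma colorsP i :
  i \in colors -> exists2 e : G * G, sadj e.1 e.2 & c [set e.1; e.2] = i.
Proof.
rewrite mem_undup => /mapP[e]; rewrite mem_enum => /imsetP[p].
by rewrite inE => pe -> ->; exists p.
Qed.

(** If no edge left the cluster, it would be the whole connected graph; then the
    ends of an edge of color [i] would be joined by edges of colors in [K], hence
    without the color [i]. *)
Lemma cluster_exit_ex v (K : pred nat) i :
    (forall x y : G, connect (@sadj G) x y) -> i \in colors -> ~~ K i ->
  exists j x, [/\ j \in colors, ~~ K j & x \in cluster_exits v K j].
Proof.
move=> connG /colorsP[[a b] /= ab <-] NKab.
have [/exists_inP[u Uu /exists_inP[x NUx ux]]|Nexit] :=
    boolP [exists u in cluster v K, exists x in ~: cluster v K, sadj u x].
  rewrite inE in NUx; have NKux := cluster_exit_color Uu NUx ux.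
  exists (c [set u; x]), x; split=> //; first exact: mem_colors.
  by rewrite [x \in _]inE NUx; apply/exists_inP; exists u; rewrite ?ux /=.
have Uclosed : closed (@sadj G) (cluster v K).
  apply: intro_closed; first exact/sym_connect_sym/sadj_sym.
  move=> u x ux Uu; apply: contraR Nexit => NUx.
  apply/exists_inP; exists u => //; apply/exists_inP; exists x => //.
  by rewrite in_setC.
have UT x : x \in cluster v K.
  by rewrite -(closed_connect Uclosed (connG v x)) inE connect0.
case/negP: NKab; apply: edge_connect_color => //.
have := UT b; rewrite inE; apply: connect_trans.
by have := UT a; rewrite inE connect_color_sym.
Qed.

(** Colors are added one at a time, each as the color of an edge leaving the
    current cluster; the base case is the single vertex [v]. *)
Lemma potential_ge v d m :
    (forall x y : G, connect (@sadj G) x y) ->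
    (forall x : G, d <= #|neighborhood x|) -> m <= size colors ->
  exists K : seq nat, [/\ uniq K, {subset K <= colors}, size K = m &
    m.+1 * d + 2 <= potential (cluster v (mem K))].
Proof.
move=> connG degG; elim: m => [_|m IHm lt_m].
  exists [::]; split=> //.
  have vU : v \in cluster v (mem [::]) by rewrite inE connect0.
  rewrite mul1n /potential /closed_neighborhood.
  set U := cluster _ _ in vU *.
  have U_gt0 : 0 < #|U| by rewrite card_gt0; apply/set0Pn; exists v.
  have leN : #|v |: neighborhood v| <= #|U :|: \bigcup_(u in U) neighborhood u|.
    apply: subset_leq_card; rewrite subUset; apply/andP; split.
      by rewrite sub1set inE vU.
    by apply: subset_trans (subsetUr _ _); apply: (bigcup_max v).
  move: leN; rewrite cardsU1 inE sadj_irrefl /=; have := degG v; lia.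
have [K [uK sK szK geK]] := IHm (ltnW lt_m).
have /allPn[i ci NKi] : ~~ all (mem K) colors.
  apply/negP => /allP sCK.
  by have := uniq_leq_size (undup_uniq _) sCK; rewrite szK leqNgt lt_m.
have [j [x [cj NKj Ax]]] := @cluster_exit_ex v (mem K) i connG ci NKi.
exists (j :: K); split=> /=.
- by rewrite uK andbT.
- by move=> k; rewrite inE => /predU1P[->|/sK].
- by rewrite szK.
have := potential_growth Ax; have := degG x.
have <- : cluster v (predU1 j (mem K)) = cluster v (mem (j :: K)).
  by apply/setP => y; rewrite !inE; apply: eq_connect.
lia.
Qed.

Lemma ncolors_bound (v : G) d :
    (forall x y : G, connect (@sadj G) x y) ->
    (forall x : G, d <= #|neighborhood x|) ->
  (ncolors c).+1 * d + 2 <= 2 * #|G|.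
Proof.
move=> connG degG.
have [K [_ _ _ geK]] := potential_ge v connG degG (leqnn (size colors)).
apply: leq_trans geK _; rewrite mul2n -addnn.
by apply: leq_add; apply: max_card.
Qed.

End Coloring.

(** * Bounds on the monochromatic disconnection number *)

Lemma md_attained (G : sgraph) :
  exists c : {set G} -> nat, MD_coloring c /\ ncolors c = md G.
Proof. by rewrite /md; case: ex_maxnP => m /asboolP. Qed.

Lemma md_bound (G : sgraph) : (0 < connectivity G)%N ->
  ((md G).+1 * connectivity G + 2 <= 2 * #|G|)%N.
Proof.
move=> G_conn; have [c [c_MD <-]] := md_attained G.
have [G0|/card_gt0P[v _]] := posnP #|G|.
  suff /(leq_trans G_conn) : (connectivity G <= #|@set0 G|)%N by rewrite cards0.
  by apply: connectivity_le; rewrite setC0 cardsT G0 orbT.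
apply: (ncolors_bound c_MD v) => [x y|x].
  exact: connectivity_gt0_connect.
exact: connectivity_le_degree.
Qed.

Lemma md_empty (G : sgraph) : #|G| = 0%N -> md G = 0%N.
Proof.
move=> G0; have [c [_ <-]] := md_attained G.
have -> : ncolors c = size (colors c) by [].
case def_C: (colors c) => [//|i C].
have /colorsP[[x y] _ _] : i \in colors c by rewrite def_C mem_head.
by have := card0_eq G0 x; rewrite inE.
Qed.

Theorem theorem4p2 (R : realType) (eps : R) (eps_gt0 : 0 < eps)
    (eps_lt_half : eps < 1 / 2) :
  exists C : R,
    C < (1 + eps) ^+ 2 / (4 * eps ^+ 2 * (1 - eps)) /\
    forall G : sgraph,
      eps * #|G|%:R <= (connectivity G)%:R -> (md G)%:R <= C.
Proof.
exists (2 / eps - 1); split.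
  have gt0 : 0 < 4 * eps ^+ 2 * (1 - eps).
    by rewrite !mulr_gt0 ?exprn_gt0 // subr_gt0; lra.
  suff : 2 / eps <= (1 + eps) ^+ 2 / (4 * eps ^+ 2 * (1 - eps)) by lra.
  rewrite ler_pdivrMr // mulrAC ler_pdivlMr //.
  (* The difference of the two sides is [eps * (1 - 3 * eps) ^+ 2]. *)
  have := mulr_ge0 (ltW eps_gt0) (sqr_ge0 (1 - 3 * eps)).
  lra.
move=> G leG; rewrite lerBrDr natr1 ler_pdivlMr //.
have [G0|n_gt0] := posnP #|G|; first by rewrite md_empty // mul1r; lra.
have k_gt0 : (0 < connectivity G)%N.
  by rewrite -(ltr_nat R); apply: lt_le_trans leG; rewrite mulr_gt0 // ltr0n.
have := md_bound k_gt0.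
rewrite -(ler_nat R) natrD !natrM => le2n.
have n_gt0R : 0 < #|G|%:R :> R by rewrite ltr0n.
rewrite -(ler_pM2r n_gt0R) -mulrA.
apply: le_trans (ler_wpM2l (ler0n _ _) leG) _.
lra.
Qed.
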